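(* If $N\geq3$ and $1<p<N$, then $D_0^{1,p}(\mathbb Z^N)=D^{1,p}(\mathbb Z^N)$.
   Context: $\mathbb Z^N$ is the integer lattice graph: $x\sim y$ iff $\sum_{i=1}^N|x_i-y_i|=1$. For $u:\mathbb Z^N\to\mathbb R$, $\lVert u\rVert_{D^{1,p}(\mathbb Z^N)}:=\left(\sum_{x\in\mathbb Z^N}\sum_{y\sim x}|u(y)-u(x)|^p\right)^{1/p}$. $D_0^{1,p}(\mathbb Z^N)$ is the completion of the finitely supported functions in this norm, its elements being regarded as functions on $\mathbb Z^N$ (a Cauchy sequence of finitely supported functions is identified with its pointwise limit), and $D^{1,p}(\mathbb Z^N):=\{u\in\ell^{\frac{Np}{N-p}}(\mathbb Z^N):\lVert u\rVert_{D^{1,p}(\mathbb Z^N)}<\infty\}$. *)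

(* Defs.v *)
From HB Require Import structures.
From mathcomp Require Import all_boot all_order all_algebra.
From mathcomp Require Import all_classical all_reals all_analysis.

Set Implicit Arguments.
Unset Strict Implicit.
Unset Printing Implicit Defensive.

Import Order.TTheory GRing.Theory Num.Theory.
Import numFieldNormedType.Exports.

Local Open Scope classical_set_scope.
Local Open Scope ring_scope.

Notation lattice N := 'rV[int]_N.

Definition lattice_adj (N : nat) (x y : lattice N) : Prop :=
  \sum_(i < N) `|x 0 i - y 0 i| = 1.

(* Extended-real valued: the norm is +oo when the double sum diverges. *)
Definition D1p_norm (R : realType) (N : nat) (p : R) (u : lattice N -> R) :
    \bar R :=
  ((\esum_(x in [set: lattice N]) \esum_(y in [set y | lattice_adj x y])
      (`|u y - u x| `^ p)%:E) `^ p^-1)%E.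

Definition finitely_supported (R : realType) (N : nat) (u : lattice N -> R) :
    Prop :=
  finite_set [set x | u x != 0].

Definition D1p_cauchy (R : realType) (N : nat) (p : R)
    (u_ : nat -> lattice N -> R) : Prop :=
  forall e : R, 0 < e -> exists n0 : nat, forall m n : nat,
    (n0 <= m)%N -> (n0 <= n)%N ->
    (D1p_norm p (fun x => u_ m x - u_ n x)%R < e%:E)%E.

(* The completion of the finitely supported functions, realised as a space of
   functions: the class of a Cauchy sequence is its pointwise limit. *)
Definition D1p_0 (R : realType) (N : nat) (p : R) : set (lattice N -> R) :=
  [set u | exists u_ : nat -> lattice N -> R,
    [/\ forall n, finitely_supported (u_ n),
        D1p_cauchy p u_ &
        forall x, u_ n x @[n --> \oo] --> u x] ].

Definition ell (R : realType) (N : nat) (q : R) : set (lattice N -> R) :=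
  [set u | summable [set: lattice N] (fun x => (`|u x| `^ q)%:E)].

Definition D1p (R : realType) (N : nat) (p : R) : set (lattice N -> R) :=
  [set u | ell (N%:R * p / (N%:R - p)) u /\ (D1p_norm p u < +oo)%E].

Arguments D1p_0 {R} N p.
Arguments D1p {R} N p.

(* Main.v *)
Require Import Defs.
From HB Require Import structures.
From mathcomp Require Import all_boot all_order all_algebra.
From mathcomp Require Import all_classical all_reals all_analysis.
From mathcomp Require Import ring lra zify.

(** The p-energy of u is the sum of |u y - u x| ^ p over ordered pairs of
    adjacent points, that is, the p-th power of its gradient norm; q denotes the
    Sobolev exponent N p / (N - p).

    A function of finite energy in l^q is the limit of its truncations in
    value, u - clamp c u, where clamp c cuts values off to [-c, c].
    Since u is in l^q, only finitely many values exceed c in absolute value, so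
    the truncation is finitely supported, without any spatial cutoff. The map
    clamp c is 1-Lipschitz and bounded by c, so the gradient of a difference of
    two truncations is at most twice that of u, and uniformly small once both
    levels are small; dominated convergence (esum_dominated_small) makes the
    truncations a Cauchy sequence.

    Conversely, let u be the pointwise limit of a Cauchy sequence u_ n of
    finitely supported functions. The differences u_ n - u_ n0 have energy at
    most 1 for a suitable n0, hence bounded l^q norm by the Sobolev inequality
    (sobolev); both bounds pass to u - u_ n0 by Fatou (esum_cvg_le), and adding
    back the finitely supported u_ n0 preserves finiteness.

    The Sobolev inequality follows the Gagliardo-Nirenberg argument. A function
    w >= 0 supported in a box is at most the sum F_i of its absolute increments
    along the line in any direction i, and F_i does not depend on the
    coordinate i. The Loomis-Whitney inequality (loomis_whitney), which is an
    induction over the coordinates with one application of Hoelder at each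
    step, bounds the sum of w ^ (N / (N - 1)), which is at most the sum of
    prod_i F_i ^ (1 / (N - 1)), by the increments alone (gagliardo_box). This
    is the case p = 1. For p > 1 it is applied to w = |v| ^ g with
    g = p (N - 1) / (N - p); the increments of w are controlled by
    |v| ^ (g - 1) times those of v, and since (g - 1) p / (p - 1) = q, Hoelder
    bounds the sum V of |v| ^ q by a power of V itself, of exponent below 1,
    times a power of the energy. As V is a finite sum, it can be absorbed
    (powR_absorb). *)

Import Order.TTheory GRing.Theory Num.Theory.
Import numFieldNormedType.Exports.

Local Open Scope classical_set_scope.
Local Open Scope ring_scope.

(** * Convexity inequalities *)

(** The tangent line of ln at the weighted mean A gives ln x <= ln A + x/A - 1;
    averaging over the x i cancels the last two terms. *)
Lemma weighted_AMGM (R : realType) (I : finType) (P : pred I) (w x : I -> R) :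
  (forall i, P i -> 0 < w i) -> \sum_(i | P i) w i = 1 ->
  (forall i, P i -> 0 <= x i) ->
  \prod_(i | P i) x i `^ w i <= \sum_(i | P i) w i * x i.
Proof.
move=> w0 w1 x0.
(* ln is only usable at positive points; a vanishing x i kills the product. *)
case: (boolP [exists (i | P i), x i == 0]) => [/exists_inP[i Pi /eqP xi0]|].
  rewrite (bigD1 i)//= xi0 powR0 ?gt_eqF ?w0// mul0r sumr_ge0// => j Pj.
  by rewrite mulr_ge0 ?x0// ltW ?w0.
rewrite negb_exists_in => /forall_inP xn0.
have xp i : P i -> 0 < x i by move=> Pi; rewrite lt_neqAle eq_sym xn0// x0.
set A := \sum_(i | P i) w i * x i.
have A0 : 0 < A.
  have [i Pi] : exists i, P i.
    apply: contrapT => /forallNP nP.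
    by move/eqP: w1; rewrite big1 ?(eq_sym 0) ?oner_eq0// => i /nP.
  rewrite /A (bigD1 i)//= ltr_wpDr ?mulr_gt0 ?w0 ?xp//.
  by rewrite sumr_ge0// => j /andP[Pj _]; rewrite mulr_ge0 ?x0// ltW ?w0.
have -> : \prod_(i | P i) x i `^ w i = expR (\sum_(i | P i) w i * ln (x i)).
  rewrite expR_sum; apply: eq_bigr => i Pi.
  by rewrite /powR gt_eqF ?xp.
rewrite -[leRHS](lnK A0) ler_expR.
have tangent i : P i -> w i * ln (x i) <= w i * x i / A + w i * (ln A - 1).
  move=> Pi; rewrite -mulrA -mulrDr ler_pM2l ?w0//.
  have xA : 0 < x i / A by rewrite divr_gt0 ?xp.
  have -> : ln (x i) = ln (x i / A) + ln A.
    by rewrite -lnM ?posrE// divfK// gt_eqF.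
  move: (x i / A) xA => y y0.
  have : ln (1 + (y - 1)) <= y - 1 by apply: le_ln1Dx; lra.
  by rewrite addrCA subrr addr0 => ?; lra.
apply: (le_trans (ler_sum _ tangent)).
by rewrite big_split/= -!mulr_suml w1 mul1r divff ?gt_eqF// addrCA subrr addr0.
Qed.

(** Once each a i is normalized to have total mass 1, this is the weighted
    arithmetic-geometric mean inequality summed over t. Equal weights serve the
    Loomis-Whitney induction, two weights the usual Hoelder inequality. *)
Lemma weighted_holder (R : realType) (I : finType) (P : pred I) (w : I -> R)
    (T : eqType) (S : seq T) (a : I -> T -> R) :
  (forall i, P i -> 0 < w i) -> \sum_(i | P i) w i = 1 ->
  (forall i t, P i -> 0 <= a i t) ->
  \sum_(t <- S) \prod_(i | P i) a i t `^ w i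
    <= \prod_(i | P i) (\sum_(t <- S) a i t) `^ w i.
Proof.
move=> w0 w1 a0.
pose A i := \sum_(t <- S) a i t.
have A0 i : P i -> 0 <= A i by move=> Pi; rewrite sumr_ge0// => t _; exact: a0.
case: (boolP [exists (i | P i), A i == 0]) => [/exists_inP[i Pi Ai0]|].
  rewrite big_seq big1 ?prodr_ge0// => [j _|t tS]; first exact: powR_ge0.
  have /eqP : a i t == 0.
    move: Ai0; rewrite /A psumr_eq0 => [/allP/(_ _ tS)//|? _]; exact: a0.
  by move=> at0; rewrite (bigD1 i)//= at0 powR0 ?mul0r// gt_eqF ?w0.
rewrite negb_exists_in => /forall_inP An0.
have Ap i : P i -> 0 < A i by move=> Pi; rewrite lt_neqAle eq_sym An0// A0.
apply: (@le_trans _ _ (\sum_(t <- S) (\prod_(i | P i) A i `^ w i) *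
    \sum_(i | P i) w i * (a i t / A i))).
  apply: ler_sum => t _.
  have -> : \prod_(i | P i) a i t `^ w i =
      (\prod_(i | P i) A i `^ w i) * \prod_(i | P i) (a i t / A i) `^ w i.
    rewrite -big_split/=; apply: eq_bigr => i Pi.
    rewrite -powRM ?A0 ?divr_ge0 ?a0 ?A0//.
    by rewrite mulrC divfK// gt_eqF ?Ap.
  rewrite ler_wpM2l ?prodr_ge0// => [i _|]; first exact: powR_ge0.
  by apply: weighted_AMGM => // i Pi; rewrite divr_ge0 ?a0 ?A0.
rewrite -mulr_sumr exchange_big/= -[leRHS]mulr1 ler_wpM2l//.
  by rewrite prodr_ge0// => i _; exact: powR_ge0.
rewrite -w1; apply: ler_sum => i Pi.
by rewrite -mulr_sumr -mulr_suml divff ?mulr1// gt_eqF ?Ap.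
Qed.

Lemma holder_seq (R : realType) (T : eqType) (S : seq T) (f g : T -> R)
    (r s : R) :
  0 < r -> 0 < s -> r + s = 1 ->
  (forall t, 0 <= f t) -> (forall t, 0 <= g t) ->
  \sum_(t <- S) f t `^ r * g t `^ s
    <= (\sum_(t <- S) f t) `^ r * (\sum_(t <- S) g t) `^ s.
Proof.
move=> r0 s0 rs f0 g0.
pose a (b : bool) := if b then f else g.
pose w (b : bool) := if b then r else s.
have h : \sum_(t <- S) \prod_(b : bool) a b t `^ w b
    <= \prod_(b : bool) (\sum_(t <- S) a b t) `^ w b.
  by apply: weighted_holder => [[]|//|[]]//; rewrite big_bool.
by move: h; rewrite big_bool/=; under eq_bigr do rewrite big_bool/=.
Qed.

(** A substitute for the mean value theorem that stays valid at 0: for b <= a it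
    reduces to the inequality of Young for b * a ^ (g - 1). *)
Lemma powR_dist_le (R : realType) (a b g : R) : 1 < g -> 0 <= a -> 0 <= b ->
  `|a `^ g - b `^ g| <= g * (a `^ (g - 1) + b `^ (g - 1)) * `|a - b|.
Proof.
move=> g1; have g0 : 0 < g by rewrite (lt_trans _ g1).
wlog ba : a b / b <= a.
  move=> H a0 b0; have [/H|/ltW/H] := leP b a; first exact.
  by rewrite distrC (distrC a) [X in _ * X * _]addrC; exact.
move=> a0 b0.
rewrite !ger0_norm ?subr_ge0//; last by rewrite ge0_ler_powR// ltW.
apply: (@le_trans _ _ (g * a `^ (g - 1) * (a - b))); last first.
  rewrite ler_wpM2r ?subr_ge0// ler_pM2l//.
  by rewrite lerDl powR_ge0.
have young : b * a `^ (g - 1) <= g^-1 * b `^ g + (1 - g^-1) * a `^ g.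
  pose w (i : bool) := if i then g^-1 else 1 - g^-1.
  pose x (i : bool) := if i then b `^ g else a `^ g.
  have := @weighted_AMGM R bool xpredT w x.
  rewrite !big_bool/= -!powRrM mulfV ?gt_eqF// powRr1//.
  rewrite mulrBr mulr1 mulfV ?gt_eqF//; apply.
  - by case=> _ /=; rewrite ?invr_gt0// subr_gt0 invf_lt1.
  - by rewrite addrCA subrr addr0.
  - by case=> _ /=; exact: powR_ge0.
have := ler_wpM2l (ltW g0) young.
rewrite mulrDr !mulrA mulrBr mulfV ?gt_eqF// mul1r mulr1 -(mulr_powRB1 a0 g0).
lra.
Qed.

(** * Unordered sums of nonnegative families *)

Lemma sum_le_esum {R : realType} {T : choiceType} (A : set T) (f : T -> R)
    (l : seq T) : uniq l -> (forall x, x \in l -> A x) ->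
  ((\sum_(x <- l) f x)%:E <= \esum_(x in A) (f x)%:E)%E.
Proof.
move=> ul lA; apply: esum_ge; exists [set` l].
  by split; [exact: finite_seq|move=> x /= /lA].
by rewrite -fsbig_seq//= sumEFin.
Qed.

Lemma esum_le_ub {R : realType} {T : choiceType} (A : set T) (f : T -> R)
    (B : R) :
  (forall l : seq T, uniq l -> (forall x, x \in l -> A x) ->
     \sum_(x <- l) f x <= B) ->
  (\esum_(x in A) (f x)%:E <= B%:E)%E.
Proof.
move=> h; apply: ge_ereal_sup => _ [X [/finite_seqP[s ->] XA] <-].
rewrite -(_ : [set` undup s] = [set` s]).
  rewrite -fsbig_seq ?undup_uniq//= sumEFin lee_fin.
  by apply: h; rewrite ?undup_uniq// => x; rewrite mem_undup => /XA.
by apply/seteqP; split=> x /=; rewrite mem_undup.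
Qed.

(** Lets a sum over an arbitrary finite list be compared with one over a fixed
    list containing the support. *)
Lemma sum_support_le {R : realType} {T : eqType} (f : T -> R) (X l : seq T) :
  (forall x, 0 <= f x) -> uniq X -> uniq l ->
  (forall x, x \in l -> x \notin X -> f x = 0) ->
  \sum_(x <- l) f x <= \sum_(x <- X) f x.
Proof.
move=> f0 uX ul fX.
rewrite (bigID (mem X))/= [X in _ + X]big_seq_cond [X in _ + X]big1 ?addr0.
  rewrite -big_filter (perm_big [seq x <- X | x \in l])/=.
    by rewrite big_filter [leRHS](bigID (mem l))/= lerDl sumr_ge0.
  by apply: uniq_perm; rewrite ?filter_uniq// => x; rewrite !mem_filter/= andbC.
by move=> x /andP[/fX].
Qed.

(** Fatou for unordered sums: a finite partial sum passes to the limit, and the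
    unordered sum is the supremum of these. *)
Lemma esum_cvg_le {R : realType} {T : choiceType} (A : set T)
    (f_ : nat -> T -> R) (f : T -> R) (B : R) (n0 : nat) :
  (forall x, f_ n x @[n --> \oo] --> f x) ->
  (forall n, (n0 <= n)%N -> (\esum_(x in A) (f_ n x)%:E <= B%:E)%E) ->
  (\esum_(x in A) (f x)%:E <= B%:E)%E.
Proof.
move=> f_f fB; apply: esum_le_ub => l ul lA.
have : \sum_(x <- l) f_ n x @[n --> \oo] --> \sum_(x <- l) f x.
  elim: l {ul lA} => [|x l IH].
    by rewrite big_nil; under eq_cvg do rewrite big_nil; exact: cvg_cst.
  by rewrite big_cons; under eq_cvg do rewrite big_cons; exact: cvgD.
move=> /cvgr_to_le; apply; near=> n; rewrite -lee_fin.
apply: le_trans (@sum_le_esum _ _ A (f_ n) l ul lA) (fB n _).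
by near: n; exact: nbhs_infty_ge.
Unshelve. all: by end_near. Qed.

Lemma esum_finite_support_lty {R : realType} {T : choiceType} (A : set T)
    (f : T -> R) (X : seq T) : (forall x, 0 <= f x) ->
  (forall x, A x -> x \notin X -> f x = 0) ->
  (\esum_(x in A) (f x)%:E < +oo)%E.
Proof.
move=> f0 fX; apply: (@le_lt_trans _ _ (\sum_(x <- undup X) f x)%:E).
  apply: esum_le_ub => l ul lA; apply: sum_support_le => //.
    exact: undup_uniq.
  by move=> x /lA Ax; rewrite mem_undup; exact: fX.
exact: ltry.
Qed.

Lemma sum_le_fine_esum {R : realType} {T : choiceType} (A : set T)
    (f : T -> R) (l : seq T) : (\esum_(x in A) (f x)%:E < +oo)%E ->
  (forall x, 0 <= f x) -> uniq l -> (forall x, x \in l -> A x) ->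
  \sum_(x <- l) f x <= fine (\esum_(x in A) (f x)%:E)%E.
Proof.
move=> foo f0 ul lA; rewrite -lee_fin fineK ?sum_le_esum//.
by rewrite ge0_fin_numE// esum_ge0// => x _; rewrite lee_fin.
Qed.

Lemma powR_normD_le {R : realType} (p a b : R) : 0 < p ->
  `|a + b| `^ p <= 2 `^ p * (`|a| `^ p + `|b| `^ p).
Proof.
move=> p0; wlog ab : a b / `|a| <= `|b|.
  move=> H; have [/H//|/ltW/H] := leP `|a| `|b|.
  by rewrite addrC [X in _ * X]addrC.
apply: (@le_trans _ _ ((2 * `|b|) `^ p)).
  rewrite ge0_ler_powR ?nnegrE ?(ltW p0)// ?mulr_ge0//.
  by rewrite (le_trans (ler_normD _ _))// mulr_natl mulr2n lerD2r.
by rewrite powRM// ler_wpM2l ?powR_ge0// lerDr powR_ge0.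
Qed.

Lemma esum_powR_normD_lty {R : realType} {T : choiceType} (A : set T)
    (f g : T -> R) (p : R) : 0 < p ->
  (\esum_(x in A) (`|f x| `^ p)%:E < +oo)%E ->
  (\esum_(x in A) (`|g x| `^ p)%:E < +oo)%E ->
  (\esum_(x in A) (`|f x + g x| `^ p)%:E < +oo)%E.
Proof.
move=> p0 foo goo.
set F := (X in (X < _)%E) in foo; set G := (X in (X < _)%E) in goo.
apply: (@le_lt_trans _ _ (2 `^ p * (fine F + fine G))%:E); last exact: ltry.
apply: esum_le_ub => l ul lA.
apply: le_trans (ler_sum _ (fun x _ => powR_normD_le p (f x) (g x) p0)) _.
rewrite -mulr_sumr big_split/= ler_wpM2l ?powR_ge0// lerD//.
  by apply: sum_le_fine_esum => // x; exact: powR_ge0.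
by apply: sum_le_fine_esum => // x; exact: powR_ge0.
Qed.

(** Continuity of |.| ^ p, including at 0, where it does not follow from the
    differentiability of powR on the open half-line. *)
Lemma cvg_powR_norm {R : realType} (p : R) (a_ : nat -> R) (a : R) : 1 < p ->
  a_ n @[n --> \oo] --> a -> `|a_ n| `^ p @[n --> \oo] --> `|a| `^ p.
Proof.
move=> p1 /cvgrPdist_le a_a; apply/cvgrPdist_le => e e0.
(* K bounds the factor given by powR_dist_le at points within 1 of a; the final
   + 1 only makes it positive. *)
pose K := p * (`|a| `^ (p - 1) + (`|a| + 1) `^ (p - 1)) + 1.
have p0 : 0 < p by rewrite (lt_trans _ p1).
have K0 : 0 < K.
  by rewrite ltr_wpDl// mulr_ge0 ?(ltW p0)// addr_ge0 ?powR_ge0.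
near=> n.
have d1 : `|a - a_ n| <= 1 by near: n; exact: a_a.
have dK : `|a - a_ n| <= e / K by near: n; apply: a_a; rewrite divr_gt0.
apply: le_trans (powR_dist_le _ _ _ _ p1 _ _) _ => //.
apply: (@le_trans _ _ (K * `|a - a_ n|)); last first.
  by rewrite mulrC -ler_pdivlMr.
apply: ler_pM => //; last exact: ler_dist_dist.
  by rewrite mulr_ge0 ?(ltW p0)// addr_ge0 ?powR_ge0.
rewrite /K ler_wpDr// ler_pM2l// lerD2l.
rewrite ge0_ler_powR ?nnegrE ?subr_ge0 ?(ltW p1)//.
rewrite addrC -lerBlDr; apply: le_trans d1.
by rewrite distrC (le_trans (lerB_dist _ _)).
Unshelve. all: by end_near. Qed.

(** Dominated convergence in a form free of sequences: outside a finite list s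
    the domination by g leaves at most e / 2, and on s a uniform bound d costs
    at most size s * d. *)
Lemma esum_dominated_small {R : realType} {T : choiceType} (A : set T)
    (g : T -> R) (e : R) : (forall x, 0 <= g x) ->
  (\esum_(x in A) (g x)%:E < +oo)%E -> 0 < e ->
  exists2 d, 0 < d & forall f : T -> R,
    (forall x, 0 <= f x <= g x) -> (forall x, f x <= d) ->
    (\esum_(x in A) (f x)%:E <= e%:E)%E.
Proof.
move=> g0 goo e0; have := fun l => @sum_le_fine_esum R T A g l goo g0.
have Gfin : \esum_(x in A) (g x)%:E \is a fin_num.
  by rewrite ge0_fin_numE// esum_ge0// => x _; rewrite lee_fin.
set G := fine _ => gG.
have [s us [sA Gs]] : exists2 s : seq T, uniq s &
    (forall x, x \in s -> A x) /\ G - e / 2 < \sum_(x <- s) g x.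
  have : ((G - e / 2)%:E < \esum_(x in A) (g x)%:E)%E.
    by rewrite -(fineK Gfin) lte_fin ltrBlDr ltrDl divr_gt0.
  move=> /ereal_sup_gt[_ [X [/finite_seqP[s ->] XA] <-]].
  rewrite -(_ : [set` undup s] = [set` s]); last first.
    by apply/seteqP; split=> x /=; rewrite mem_undup.
  rewrite -fsbig_seq ?undup_uniq//= sumEFin lte_fin => Gs.
  exists (undup s); first exact: undup_uniq.
  by split=> // x; rewrite mem_undup => /XA.
(* The successor avoids dividing by 0 when s is empty. *)
exists (e / 2 / (size s).+1%:R); first by rewrite !divr_gt0.
set d := _ / _ => f fg fd; apply: esum_le_ub => l ul lA.
have d0 : 0 <= d by rewrite ltW// !divr_gt0.
have near_part : \sum_(x <- l | x \in s) f x <= e / 2.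
  apply: (@le_trans _ _ (\sum_(x <- l | x \in s) d)); first exact: ler_sum.
  rewrite -big_filter big_const_seq count_predT iter_addr_0.
  apply: (@le_trans _ _ (d *+ (size s).+1)).
    rewrite -[leLHS]mulr_natr -[leRHS]mulr_natr ler_wpM2l// ler_nat leqW//.
    rewrite uniq_leq_size ?filter_uniq// => x.
    by rewrite mem_filter => /andP[].
  by rewrite -mulr_natr divfK.
have far_part : \sum_(x <- l | x \notin s) f x <= e / 2.
  apply: (@le_trans _ _ (\sum_(x <- l | x \notin s) g x)).
    by apply: ler_sum => x _; have /andP[] := fg x.
  have := gG ([seq x <- l | x \notin s] ++ s).
  rewrite big_cat big_filter/= => h.
  suff : \sum_(x <- l | x \notin s) g x + \sum_(x <- s) g x <= G by lra.
  apply: h; last first.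
    by move=> x; rewrite mem_cat mem_filter => /orP[/andP[_ /lA]|/sA].
  rewrite cat_uniq filter_uniq// us andbT; apply/hasPn => x xs.
  by rewrite mem_filter xs.
rewrite (bigID (mem s))/=; lra.
Qed.

(** Otherwise the superlevel set would contain more than (sum f) / c points,
    each contributing at least c. *)
Lemma finite_superlevel {R : realType} {T : choiceType} (f : T -> R) (c : R) :
  (forall x, 0 <= f x) -> (\esum_(x in [set: T]) (f x)%:E < +oo)%E -> 0 < c ->
  finite_set [set x | c <= f x].
Proof.
move=> f0 foo c0; apply: contrapT => inf.
have := fun l => @sum_le_fine_esum R T setT f l foo f0; set G := fine _ => fG.
have [X Xc nX] := infinite_set_fset (Num.Def.archi_bound (G / c)) inf.
have G0 : 0 <= G by have := fG [::]; rewrite big_nil => ->.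
have := fG (finmap.enum_fset X) (finmap.fset_uniq X) (fun _ _ => I).
apply/negP; rewrite -ltNge.
have : G / c < (size (finmap.enum_fset X))%:R.
  by rewrite (lt_le_trans (archi_boundP _)) ?ler_nat ?divr_ge0 ?(ltW c0).
rewrite ltr_pdivrMr// => /lt_le_trans; apply.
rewrite mulr_natl -iter_addr_0 -count_predT -big_const_seq.
by rewrite big_seq [leRHS]big_seq; apply: ler_sum => x /Xc.
Qed.

(** * The Loomis-Whitney inequality *)

Definition upd {N : nat} (k : 'I_N) (t : int) (x : lattice N) : lattice N :=
  \row_j (if j == k then t else x 0 j).

Lemma upd_upd {N : nat} (k : 'I_N) (t t' : int) (x : lattice N) :
  upd k t (upd k t' x) = upd k t x.
Proof. by apply/rowP => j; rewrite !mxE; case: eqP. Qed.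

Lemma updC {N : nat} (j k : 'I_N) (a b : int) (x : lattice N) : j != k ->
  upd j a (upd k b x) = upd k b (upd j a x).
Proof.
move=> jk; apply/rowP => i; rewrite !mxE.
by case: (eqVneq i j) => [->|//]; rewrite (negbTE jk).
Qed.

Lemma upd_self {N : nat} (k : 'I_N) (x : lattice N) : upd k (x 0 k) x = x.
Proof. by apply/rowP => j; rewrite !mxE; case: eqP => [->|]. Qed.

Definition slice_sum {R : realType} {N : nat} (S : seq int) (k : 'I_N)
    (f : lattice N -> R) (x : lattice N) : R :=
  \sum_(t <- S) f (upd k t x).

Definition slice_sums {R : realType} {N : nat} (S : seq int) (s : seq 'I_N)
    (f : lattice N -> R) : lattice N -> R :=
  foldr (slice_sum S) f s.

Section SliceSums.
Context {R : realType} {N : nat} (S : seq int).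
Implicit Types (s : seq 'I_N) (f g : lattice N -> R) (x : lattice N).

Lemma slice_sums_ge0 s f x : (forall y, 0 <= f y) -> 0 <= slice_sums S s f x.
Proof.
by move=> f0; elim: s x => [//|k s IH] x; rewrite /= sumr_ge0.
Qed.

Lemma le_slice_sums s f g x : (forall y, f y <= g y) ->
  slice_sums S s f x <= slice_sums S s g x.
Proof.
by move=> fg; elim: s x => [//|k s IH] x; rewrite /= ler_sum.
Qed.

(** Slice sums in other directions keep independence of the coordinate k: this
    is what lets one factor be pulled out at each Loomis-Whitney step. *)
Lemma slice_sums_upd s f k t x : k \notin s ->
  (forall u y, f (upd k u y) = f y) ->
  slice_sums S s f (upd k t x) = slice_sums S s f x.
Proof.
move=> + fk; elim: s x => [|j s IH] x /=; first by rewrite fk.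
rewrite inE negb_or => /andP[kj ks]; apply: eq_bigr => u _.
by rewrite updC 1?eq_sym// IH.
Qed.

(** The coordinates in s are summed one at a time. When the coordinate k is
    summed, the factor of index k is constant and comes out of the sum; the
    N - 1 remaining ones are treated by Hoelder with equal weights 1 / (N - 1),
    which turns the sum of the product into the product of the sums over the
    coordinate k. Hence F i ends up summed over all of s except i. *)
Lemma loomis_whitney (F : 'I_N -> lattice N -> R) s x : (1 < N)%N ->
  (forall i y, 0 <= F i y) -> (forall i t y, F i (upd i t y) = F i y) ->
  slice_sums S s (fun y => \prod_i F i y `^ (N.-1)%:R^-1) x
    <= \prod_i slice_sums S [seq j <- s | j != i] (F i) x `^ (N.-1)%:R^-1.
Proof.
move=> N1 F0 Fi; have Np : 0 < (N.-1)%:R :> R by rewrite ltr0n; lia.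
elim: s x => [//|k s IH] x /=.
apply: le_trans (ler_sum _ (fun t _ => IH (upd k t x))) _.
rewrite (bigD1 k)//= eqxx/=.
under eq_bigr => t _.
  rewrite (bigD1 k)//= slice_sums_upd//; last by rewrite mem_filter eqxx.
  over.
rewrite -mulr_sumr ler_wpM2l ?powR_ge0//.
apply: le_trans (weighted_holder _ _ _ _ _ _ _ _ _ _) _.
- by move=> i _; rewrite invr_gt0.
- by rewrite sumr_const cardC1 card_ord -[LHS]mulr_natr mulVf// gt_eqF.
- by move=> i t _; exact: slice_sums_ge0.
by under [leRHS]eq_bigr => i ik do rewrite eq_sym ik/=.
Qed.

End SliceSums.

(** Flattening the iterated sums of slice_sums into a single list of points
    makes the order of summation irrelevant. *)
Fixpoint grid {N : nat} (S : seq int) (s : seq 'I_N) (x : lattice N) :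
    seq (lattice N) :=
  if s is k :: s' then [seq y | t <- S, y <- grid S s' (upd k t x)]
  else [:: x].

Lemma slice_sums_grid {R : realType} {N : nat} (S : seq int) (s : seq 'I_N)
    (f : lattice N -> R) (x : lattice N) :
  slice_sums S s f x = \sum_(y <- grid S s x) f y.
Proof.
elim: s x => [|k s IH] x /=; first by rewrite big_seq1.
by rewrite big_allpairs_dep; apply: eq_bigr => t _; rewrite IH.
Qed.

Lemma mem_grid {N : nat} (S : seq int) (s : seq 'I_N) (x y : lattice N) :
  uniq s ->
  (y \in grid S s x) =
  [forall j, if j \in s then y 0 j \in S else y 0 j == x 0 j].
Proof.
elim: s x y => [|k s IH] x y /=.
  move=> _; rewrite inE; apply/eqP/forallP => [-> j|h]; first by rewrite eqxx.
  by apply/rowP => j; apply/eqP/h.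
move=> /andP[ks us]; apply/allpairsPdep/forallP => [[t [z [tS + ->]]] j|h].
  rewrite IH// => /forallP /(_ j); rewrite inE.
  case: (eqVneq j k) => [->|jk] /=; last by rewrite mxE (negbTE jk).
  by rewrite (negbTE ks) mxE eqxx => /eqP ->.
exists (y 0 k), y; split => //.
  by have := h k; rewrite inE eqxx.
rewrite IH//; apply/forallP => j; have := h j; rewrite inE mxE.
by case: (eqVneq j k) => [->|jk]//=; rewrite (negbTE ks) eqxx.
Qed.

Lemma grid_uniq {N : nat} (S : seq int) (s : seq 'I_N) (x : lattice N) :
  uniq S -> uniq s -> uniq (grid S s x).
Proof.
move=> uS; elim: s x => [//|k s IH] x /= /andP[ks us].
suff uS'x S' : uniq S' -> uniq [seq y | t <- S', y <- grid S s (upd k t x)].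
  exact: uS'x.
elim: S' => [//|t S' IHS] /= /andP[tS' uS'].
rewrite map_id cat_uniq IH// IHS//= andbT.
apply/hasPn => y /allpairsPdep[t' [z [t'S' + ->]]].
rewrite !mem_grid// => /forallP /(_ k).
rewrite (negbTE ks) mxE eqxx => /eqP zk.
apply/forallPn; exists k; rewrite (negbTE ks) mxE eqxx zk.
by apply: contraNneq tS' => <-.
Qed.

(** * Boxes and line increments *)

Definition sym_range (M : nat) : seq int :=
  [seq k%:Z - M%:Z | k <- iota 0 (M + M).+1].

Lemma mem_sym_range (M : nat) (t : int) : (t \in sym_range M) = (`|t| <= M)%N.
Proof.
apply/mapP/idP => [[k + ->]|tM]; first by rewrite mem_iota; lia.
by exists (absz (t + M%:Z)); rewrite ?mem_iota; lia.
Qed.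

Lemma sym_range_uniq (M : nat) : uniq (sym_range M).
Proof. by rewrite map_inj_uniq ?iota_uniq// => a b /=; lia. Qed.

(** Since g vanishes beyond the range, g t is minus the sum of the increments
    from t on; the last one leaves the range, at M + 1. *)
Lemma telescope_sym_range {R : realType} (M : nat) (g : int -> R) (t : int) :
  (forall u, u \notin sym_range M -> g u = 0) ->
  `|g t| <= \sum_(u <- sym_range M) `|g (u + 1) - g u|.
Proof.
move=> g0; have [tM|/g0 ->] := boolP (t \in sym_range M); last first.
  by rewrite normr0 sumr_ge0.
pose h (k : nat) := g (k%:Z - M%:Z).
have /mapP[k kM tk] := tM.
have kle : (k <= (M + M).+1)%N by move: kM; rewrite mem_iota; lia.
have -> : g t = - \sum_(k <= j < (M + M).+1) (h j.+1 - h j).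
  rewrite telescope_sumr// /h -tk (g0 ((M + M).+1%:Z - M%:Z)) ?sub0r ?opprK//.
  by rewrite mem_sym_range; lia.
rewrite normrN (le_trans (ler_norm_sum _ _ _))// big_map.
rewrite -[iota 0 _]/(index_iota 0 (M + M).+1) (big_cat_nat (leq0n k) kle)//=.
rewrite ler_wpDl ?sumr_ge0//; apply: ler_sum => j _.
by rewrite /h (_ : j.+1%:Z - M%:Z = j%:Z - M%:Z + 1)//; lia.
Qed.

Definition step {N : nat} (i : 'I_N) (x : lattice N) : lattice N :=
  upd i (x 0 i + 1) x.

Lemma step_upd {N : nat} (i : 'I_N) (t : int) (x : lattice N) :
  step i (upd i t x) = upd i (t + 1) x.
Proof. by rewrite /step upd_upd mxE eqxx. Qed.

Lemma step_inj {N : nat} (i : 'I_N) : injective (@step N i).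
Proof.
move=> x y /rowP e; apply/rowP => j; have := e j; rewrite !mxE.
by case: eqP => [->|//] /addIr.
Qed.

Lemma adj_step {N : nat} (i : 'I_N) (x : lattice N) :
  lattice_adj x (step i x).
Proof.
rewrite /lattice_adj (bigD1 i)//= big1 => [|j /negbTE ji].
  by rewrite mxE eqxx addr0; lia.
by rewrite mxE ji subrr.
Qed.

Definition box {N : nat} (M : nat) : seq (lattice N) :=
  grid (sym_range M) (enum 'I_N) 0.

Lemma mem_box {N : nat} (M : nat) (x : lattice N) :
  (x \in box M) = [forall i, (`|x 0%R i| <= M)%N].
Proof.
rewrite mem_grid ?enum_uniq//; apply: eq_forallb => i.
by rewrite mem_enum mem_sym_range.
Qed.

Lemma box_uniq {N : nat} (M : nat) : uniq (@box N M).
Proof. by rewrite grid_uniq ?enum_uniq ?sym_range_uniq. Qed.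

Lemma finite_set_box {N : nat} (A : set (lattice N)) :
  finite_set A -> exists M, forall x, A x -> x \in box M.
Proof.
move=> /finite_seqP[s ->].
exists (\max_(x <- s) \max_i `|x 0%R i|%N)%N => x /= xs.
rewrite mem_box; apply/forallP => i.
apply: (@leq_trans (\max_i `|x 0%R i|)%N).
  exact: (leq_bigmax (F := fun i => `|x 0%R i|%N)).
exact: (leq_bigmax_seq (F := fun x : lattice N => \max_i `|x 0%R i|)%N).
Qed.

(** The Sobolev inequality for p = 1. Each of the N line sums of |dw| dominates
    w, so w ^ (N / (N - 1)) is at most the product of their powers of exponent
    1 / (N - 1), to which the Loomis-Whitney inequality applies. *)
Lemma gagliardo_box {R : realType} {N M : nat} (w : lattice N -> R) :
  (1 < N)%N -> (forall x, 0 <= w x) ->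
  (forall x, x \notin box M -> w x = 0) ->
  \sum_(x <- box M) w x `^ (N%:R / N.-1%:R)
    <= \prod_i (\sum_(x <- box M) `|w (step i x) - w x|) `^ N.-1%:R^-1.
Proof.
move=> N1 w0 wM; set S := sym_range M.
(* F i is constant along direction i and dominates w by telescoping. *)
pose F i := slice_sum S i (fun x => `|w (step i x) - w x|).
have F0 i x : 0 <= F i x by rewrite sumr_ge0.
have wF i x : w x <= F i x.
  rewrite -[leLHS]ger0_norm// -{1}(upd_self i x) /F /slice_sum.
  under eq_bigr do rewrite step_upd.
  apply: (@telescope_sym_range _ _ (fun t => w (upd i t x))) => u uM; apply: wM.
  rewrite mem_box; apply/forallPn; exists i.
  by rewrite mxE eqxx -mem_sym_range.
rewrite -slice_sums_grid.
apply: (@le_trans _ _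
    (slice_sums S (enum 'I_N) (fun y => \prod_i F i y `^ N.-1%:R^-1) 0)).
  apply: le_slice_sums => y.
  rewrite mulrC powRrM powR_mulrn ?powR_ge0//.
  rewrite -[X in _ ^+ X]card_ord -prodr_const; apply: ler_prod => i _.
  by rewrite powR_ge0/= ge0_ler_powR ?nnegrE ?invr_ge0 ?ler0n.
apply: le_trans (loomis_whitney S F (enum 'I_N) 0 N1 F0 _) _.
  by move=> i t y; apply: eq_bigr => u _; rewrite upd_upd.
rewrite le_eqVlt; apply/orP; left; apply/eqP; apply: eq_bigr => i _.
congr (_ `^ _).
set h := fun x => `|w (step i x) - w x|.
(* F i is itself a slice sum in the missing direction i, so all coordinates are
   now summed, merely in another order than in the box. *)
have -> : slice_sums S [seq j <- enum 'I_N | j != i] (F i) 0 =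
    slice_sums S (rcons [seq j <- enum 'I_N | j != i] i) h 0.
  by rewrite /slice_sums foldr_rcons.
have us : uniq (rcons [seq j <- enum 'I_N | j != i] i).
  by rewrite rcons_uniq mem_filter eqxx filter_uniq ?enum_uniq.
rewrite slice_sums_grid; apply: perm_big; apply: uniq_perm.
- by rewrite grid_uniq ?sym_range_uniq.
- exact: box_uniq.
move=> y; rewrite mem_grid// mem_box; apply: eq_forallb => j.
by rewrite mem_rcons inE mem_filter mem_enum andbT orbN mem_sym_range.
Qed.

(** Dividing by V ^ (r a), of exponent below 1, leaves a positive power of V
    on the left; the finiteness of V is what makes this legitimate. *)
Lemma powR_absorb {R : realType} (V K r a : R) :
  0 <= V -> 0 <= K -> 0 < a -> r * a < 1 ->
  V <= (V `^ r * K) `^ a -> V <= K `^ (a / (1 - r * a)).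
Proof.
move=> V0 K0 a0 ra; move: V0; rewrite le_eqVlt => /predU1P[<- _|V0].
  exact: powR_ge0.
rewrite powRM ?powR_ge0// -powRrM => h.
have {}h : V `^ (1 - r * a) <= K `^ a.
  rewrite powRB ?gt_eqF ?implybT// powRr1 ?(ltW V0)//.
  by rewrite ler_pdivrMr ?powR_gt0// mulrC.
have := @ge0_ler_powR R (1 - r * a)^-1 _ _ _ _ _ h.
rewrite -!powRrM mulfV ?powRr1 ?(ltW V0)//; last by rewrite gt_eqF// subr_gt0.
by apply; rewrite ?nnegrE ?powR_ge0// invr_ge0 subr_ge0 ltW.
Qed.

(** * Energy and summability *)

Definition edges (N : nat) : set (lattice N * lattice N) :=
  [set e | lattice_adj e.1 e.2].

Definition energy {R : realType} {N : nat} (p : R) (u : lattice N -> R) :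
    \bar R :=
  (\esum_(e in edges N) (`|u e.2 - u e.1| `^ p)%:E)%E.

Lemma D1p_normE {R : realType} {N : nat} (p : R) (u : lattice N -> R) :
  D1p_norm p u = (energy p u `^ p^-1)%E.
Proof.
rewrite /D1p_norm esum_esum => [|x y _ _]; last by rewrite lee_fin powR_ge0.
congr (_ `^ _)%E; congr (\esum_(e in _) _)%E.
by apply/seteqP; split => [e []|e].
Qed.

Lemma energy_ge0 {R : realType} {N : nat} (p : R) (u : lattice N -> R) :
  (0 <= energy p u)%E.
Proof. by apply: esum_ge0 => e _; rewrite lee_fin powR_ge0. Qed.

Lemma D1p_norm_lt {R : realType} {N : nat} (p e : R) (u : lattice N -> R) :
  0 < p -> 0 < e -> (D1p_norm p u < e%:E)%E = (energy p u < (e `^ p)%:E)%E.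
Proof.
move=> p0 e0; have pV : 0 < p^-1 by rewrite invr_gt0.
rewrite D1p_normE; have := energy_ge0 p u; case: (energy p u) => [a|_|//].
  rewrite lee_fin poweR_EFin !lte_fin => a0; apply/idP/idP => h.
    have := gt0_ltr_powR p0 _ _ h; rewrite -powRrM mulVf ?gt_eqF// powRr1//.
    by apply; rewrite nnegrE ?powR_ge0 ?(ltW e0).
  have := gt0_ltr_powR pV _ _ h.
  rewrite -powRrM mulfV ?gt_eqF// powRr1 ?(ltW e0)//.
  by apply; rewrite nnegrE ?powR_ge0.
by rewrite poweRyr ?gt_eqF.
Qed.

Lemma D1p_norm_lty {R : realType} {N : nat} (p : R) (u : lattice N -> R) :
  0 < p -> (D1p_norm p u < +oo)%E <-> (energy p u < +oo)%E.
Proof.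
move=> p0; rewrite D1p_normE; split => [|/poweR_lty//].
by apply: lty_poweRy; rewrite invr_eq0 gt_eqF.
Qed.

Lemma ellE {R : realType} {N : nat} (q : R) (u : lattice N -> R) :
  ell q u <-> (\esum_(x in [set: lattice N]) (`|u x| `^ q)%:E < +oo)%E.
Proof.
rewrite /ell /= /summable.
under eq_esum do rewrite gee0_abs ?lee_fin ?powR_ge0//.
by [].
Qed.

Lemma finitely_supported_ell {R : realType} {N : nat} (q : R)
    (u : lattice N -> R) : 0 < q -> finitely_supported u ->
  (\esum_(x in [set: lattice N]) (`|u x| `^ q)%:E < +oo)%E.
Proof.
move=> q0 /finite_set_box[M uM].
apply: (@esum_finite_support_lty _ _ _ _ (box M)) => [x|x _ xM].
  exact: powR_ge0.
have [->|/uM] := eqVneq (u x) 0; first by rewrite normr0 powR0// gt_eqF.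
by rewrite (negbTE xM).
Qed.

Lemma lattice_adj_coord {N : nat} (x y : lattice N) (i : 'I_N) :
  lattice_adj x y -> `|x 0 i - y 0 i| <= 1.
Proof. by move=> <-; rewrite (bigD1 i)//= lerDl sumr_ge0. Qed.

(** An edge with a nonzero increment has an end in the support, so both its ends
    lie in the box enlarged by 1. *)
Lemma finitely_supported_energy {R : realType} {N : nat} (p : R)
    (u : lattice N -> R) : 0 < p -> finitely_supported u ->
  (energy p u < +oo)%E.
Proof.
move=> p0 /finite_set_box[M uM].
apply: (@esum_finite_support_lty _ _ _ _
  [seq (x, y) | x <- box M.+1, y <- box M.+1]) => [e|[x y] /= xy xyM].
  exact: powR_ge0.
suff /andP[/eqP -> /eqP ->] : (u x == 0) && (u y == 0).
  by rewrite subrr normr0 powR0// gt_eqF.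
apply: contraNT xyM; rewrite negb_and => uxy.
have bound i : (`|x 0%R i| <= M)%N || (`|y 0%R i| <= M)%N.
  move: uxy => /orP[] /uM;
    by rewrite mem_box => /forallP /(_ i) ->; rewrite ?orbT.
apply/allpairsP; exists (x, y); split => //=; rewrite mem_box;
  apply/forallP => i /=;
  have := lattice_adj_coord x y i xy; have := bound i;
  by move: (x 0 i) (y 0 i) => a b; lia.
Qed.

(** * The Sobolev inequality *)

Definition sobolev_const {R : realType} (N : nat) (p : R) : R :=
  (2 * (p * N.-1%:R / (N%:R - p))) `^ (N%:R * p / (N%:R - p)).

(** The case p = 1 for |v| ^ g; both ends of an edge contribute a factor of
    exponent g - 1 to its increment, whence the constant 2 g. *)
Lemma sobolev {R : realType} {N : nat} (p D : R) (v : lattice N -> R) :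
  1 < p -> p < N%:R -> finitely_supported v -> (energy p v <= D%:E)%E ->
  (\esum_(x in [set: lattice N]) (`|v x| `^ (N%:R * p / (N%:R - p)))%:E
    <= (sobolev_const N p * D `^ (N%:R / (N%:R - p)))%:E)%E.
Proof.
move=> p1 pN /finite_set_box[M vM] vD.
have N1 : (1 < N)%N by rewrite -(ltr_nat R) (lt_trans p1).
rewrite /sobolev_const; set n : R := N%:R; set q := n * p / _.
have mE : N.-1%:R = n - 1 :> R by rewrite -subn1 natrB// ltnW.
rewrite mE; set g := p * (n - 1) / (n - p).
have np : 0 < n - p by rewrite subr_gt0.
have p0 : 0 < p by rewrite (lt_trans _ p1).
have n0 : 0 < n by rewrite (lt_trans p0).
have m0 : 0 < n - 1 by rewrite subr_gt0 (lt_trans p1).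
have q0 : 0 < q by rewrite divr_gt0// mulr_gt0.
have g1 : 1 < g by rewrite ltr_pdivlMr//; nra.
have g0 : 0 < g by rewrite (lt_trans _ g1).
have v0 x : x \notin box M -> v x = 0.
  by move=> xM; apply/eqP/negPn/negP => /vM; rewrite (negbTE xM).
pose V := \sum_(x <- box M) `|v x| `^ q.
have V_ub l : uniq l -> \sum_(x <- l) `|v x| `^ q <= V.
  move=> ul; apply: sum_support_le; rewrite ?box_uniq// => x _ /v0 ->.
  by rewrite normr0 powR0// gt_eqF.
have V0 : 0 <= V by rewrite sumr_ge0// => x _; exact: powR_ge0.
have dD i : \sum_(x <- box M) `|v (step i x) - v x| `^ p <= D.
  rewrite -lee_fin; apply: le_trans vD.
  have := @sum_le_esum R _ (edges N) (fun e => `|v e.2 - v e.1| `^ p)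
    [seq (x, step i x) | x <- box M].
  rewrite big_map/=; apply.
    by rewrite map_inj_uniq ?box_uniq// => x y [].
  by move=> _ /mapP[x _ ->]; exact: adj_step.
have D0 : 0 <= D.
  have i : 'I_N by exact: (Ordinal (ltnW N1)).
  by apply: le_trans (dD i); rewrite sumr_ge0// => x _; exact: powR_ge0.
pose r := 1 - p^-1.
have p1' : 0 < p^-1 by rewrite invr_gt0.
have r0 : 0 < r by rewrite subr_gt0 invf_lt1.
(* The choice of g makes |v| ^ (g - 1) dual to the increments of v in l^p. *)
have qr : q * r = g - 1.
  rewrite /q /r /g; field; rewrite ?gt_eqF//.
have holder i (y : lattice N -> lattice N) : injective y ->
    \sum_(x <- box M) `|v (y x)| `^ (g - 1) * `|v (step i x) - v x|
      <= V `^ r * D `^ p^-1.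
  move=> yI.
  have := @holder_seq R _ (box M) (fun x => `|v (y x)| `^ q)
    (fun x => `|v (step i x) - v x| `^ p) r p^-1 r0 p1'.
  rewrite subrK => /(_ erefl).
  under eq_bigr do rewrite -!powRrM qr mulfV ?gt_eqF// powRr1//.
  move=> h; apply: le_trans (h _ _) _ => [x|x|]; [exact: powR_ge0..|].
  apply: ler_pM; rewrite ?powR_ge0//.
    rewrite ge0_ler_powR ?nnegrE ?(ltW r0)//.
      by rewrite sumr_ge0// => *; exact: powR_ge0.
    rewrite -(big_map y xpredT (fun x => `|v x| `^ q)) V_ub//.
    by rewrite map_inj_uniq ?box_uniq.
  rewrite ge0_ler_powR ?nnegrE ?(ltW p1')//.
  by rewrite sumr_ge0// => *; exact: powR_ge0.
pose w x := `|v x| `^ g.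
have dw i : \sum_(x <- box M) `|w (step i x) - w x|
    <= V `^ r * (2 * g * D `^ p^-1).
  have -> : V `^ r * (2 * g * D `^ p^-1) =
      g * (V `^ r * D `^ p^-1 + V `^ r * D `^ p^-1) by ring.
  apply: le_trans (_ : g * (
      \sum_(x <- box M) `|v (step i x)| `^ (g - 1) * `|v (step i x) - v x| +
      \sum_(x <- box M) `|v x| `^ (g - 1) * `|v (step i x) - v x|) <= _).
    rewrite -big_split mulr_sumr; apply: ler_sum => x _ /=.
    apply: le_trans (powR_dist_le _ _ _ _ g1 _ _) _ => //.
    rewrite -mulrDl mulrA ler_wpM2l//; last exact: ler_dist_dist.
    by rewrite mulr_ge0 ?(ltW g0)// addr_ge0 ?powR_ge0.
  rewrite ler_pM2l// lerD//; first exact/holder/step_inj.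
  by apply: (holder i id) => ? ?.
have dw0 i : 0 <= \sum_(x <- box M) `|w (step i x) - w x|.
  by rewrite sumr_ge0.
have E0 : 0 <= V `^ r * (2 * g * D `^ p^-1).
  by rewrite mulr_ge0 ?powR_ge0// mulr_ge0 ?powR_ge0// mulr_ge0// ltW.
have := @gagliardo_box R N M w N1.
rewrite mE => /(_ _ _)/le_trans main.
have {main} VV : V <= (V `^ r * (2 * g * D `^ p^-1)) `^ (n / (n - 1)).
  have VE : V = \sum_(x <- box M) w x `^ (n / (n - 1)).
    apply: eq_bigr => x _; rewrite -powRrM; congr (_ `^ _).
    rewrite /q /g; field; rewrite ?gt_eqF//.
  rewrite {1}VE; apply: main => [x|x xM|]; first exact: powR_ge0.
    by rewrite /w v0// normr0 powR0// gt_eqF.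
  rewrite [n / _]mulrC powRrM powR_mulrn ?powR_ge0//.
  rewrite -[X in _ ^+ X]card_ord -prodr_const; apply: ler_prod => i _.
  apply/andP; split; first exact: powR_ge0.
  by apply: ge0_ler_powR; rewrite ?nnegrE ?invr_ge0 ?(ltW m0)// dw.
apply: esum_le_ub => l ul _; apply: le_trans (V_ub _ ul) _.
(* r n / (n - 1) < 1 amounts to p < N. *)
have ra : r * (n / (n - 1)) < 1.
  rewrite mulrA ltr_pdivrMr// mul1r /r mulrBl mul1r ltrD2l ltrN2.
  by rewrite mulrC ltr_pdivlMr ?mul1r.
apply: le_trans (powR_absorb _ _ _ _ V0 _ _ ra VV) _.
- by rewrite mulr_ge0 ?powR_ge0// mulr_ge0// ltW.
- by rewrite divr_gt0.
rewrite powRM; [|by rewrite mulr_ge0 // ltW|exact: powR_ge0].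
rewrite -[(D `^ _) `^ _]powRrM.
have -> : n / (n - 1) / (1 - r * (n / (n - 1))) = q.
  rewrite /r /q; field; rewrite ?gt_eqF//.
rewrite /q (_ : p^-1 * (n * p / (n - p)) = n / (n - p))//.
by field; rewrite ?gt_eqF.
Qed.

(** * Truncation in value *)

Definition clamp {R : realType} (c s : R) : R := Num.max (- c) (Num.min s c).

Lemma clamp_cases {R : realType} (c s : R) : 0 <= c ->
  [\/ s <= - c /\ clamp c s = - c, - c <= s <= c /\ clamp c s = s
    | c <= s /\ clamp c s = c].
Proof.
move=> c0; rewrite /clamp; case: (leP s c) => sc.
  by case: (leP (- c) s) => cs; [apply: Or32|apply: Or31]; rewrite ?cs ?ltW.
by rewrite max_r; [apply: Or33; rewrite ltW|lra].
Qed.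

Lemma clamp_norm {R : realType} (c s : R) : 0 <= c -> `|clamp c s| <= c.
Proof.
move=> c0; rewrite ler_norml.
by have [[? ->]|[? ->]|[? ->]] := clamp_cases c s c0; lra.
Qed.

Lemma clamp_id {R : realType} (c s : R) : `|s| <= c -> clamp c s = s.
Proof.
move=> sc; have c0 := le_trans (normr_ge0 s) sc.
by move: sc (clamp_cases c s c0); rewrite ler_norml => /andP[? ?] [][? ->]; lra.
Qed.

Lemma clamp_lipschitz {R : realType} (c a b : R) : 0 <= c ->
  `|clamp c a - clamp c b| <= `|a - b|.
Proof.
move=> c0; wlog ba : a b / b <= a.
  move=> H; have [/H//|/ltW/H] := leP b a.
  by rewrite distrC (distrC b).
rewrite (@ger0_norm _ (a - b)) ?subr_ge0// ler_norml.
by have [[? ->]|[? ->]|[? ->]] := clamp_cases c a c0;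
  have [[? ->]|[? ->]|[? ->]] := clamp_cases c b c0; lra.
Qed.

(** * The two inclusions *)

Lemma D1p_0_sub {R : realType} {N : nat} (p : R) : 1 < p -> p < N%:R ->
  D1p_0 N p `<=` D1p N p.
Proof.
move=> p1 pN; have p0 : 0 < p by exact: lt_trans p1.
have q1 : 1 < N%:R * p / (N%:R - p) by rewrite ltr_pdivlMr ?subr_gt0//; nra.
have q0 := lt_trans ltr01 q1; set q := (X in 1 < X) in q1 q0.
move=> u [u_ [u_fin u_cauchy u_u]].
have [n0 /(_ _ n0 _ (leqnn n0)) u_n0] := u_cauchy 1 ltr01.
set z := u_ n0 in u_n0; pose v_ n x := u_ n x - z x.
have v_fin n : finitely_supported (v_ n).
  apply: (@sub_finite_set _ _ ([set x | u_ n x != 0] `|` [set x | z x != 0])).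
    move=> x; rewrite /v_ /=.
    have [->|] := eqVneq (u_ n x) 0; last by left.
    by have [->|] := eqVneq (z x) 0; [rewrite subrr eqxx|right].
  by rewrite finite_setU; split; exact: u_fin.
have v_energy n : (n0 <= n)%N -> (energy p (v_ n) <= 1%:E)%E.
  by move=> /u_n0; rewrite D1p_norm_lt// powR1 => /ltW.
have v_u x : v_ n x @[n --> \oo] --> u x - z x.
  by apply: cvgB; [exact: u_u|exact: cvg_cst].
(* Only differences with z have controlled energy; z is added back later. *)
have uE : u = (fun x => (u x - z x) + z x).
  by apply/funext => x; rewrite subrK.
split.
  apply/ellE; rewrite uE; apply: esum_powR_normD_lty => //; last first.
    by apply: finitely_supported_ell => //; exact: u_fin.
  apply: le_lt_trans (ltry _); apply: (@esum_cvg_le _ _ _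
    (fun n x => `|v_ n x| `^ q) _ _ n0) => [x|n n0n].
    exact: cvg_powR_norm.
  exact: sobolev p1 pN (v_fin n) (v_energy n n0n).
apply/(D1p_norm_lty _ _ p0).
have -> : energy p u = (\esum_(e in edges N)
    (`|((u e.2 - z e.2) - (u e.1 - z e.1)) + (z e.2 - z e.1)| `^ p)%:E)%E.
  apply: eq_esum => e _; congr (`|_| `^ _)%:E; ring.
apply: esum_powR_normD_lty => //; last first.
  exact: finitely_supported_energy (u_fin _).
apply: le_lt_trans (ltry 1); apply: (@esum_cvg_le _ _ _
  (fun n e => `|v_ n e.2 - v_ n e.1| `^ p) _ _ n0) => [e|n n0n].
  by apply: cvg_powR_norm => //; apply: cvgB; exact: v_u.
exact: v_energy.
Qed.

Lemma D1p_sub {R : realType} {N : nat} (p : R) : 1 < p -> p < N%:R ->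
  D1p N p `<=` D1p_0 N p.
Proof.
move=> p1 pN; have p0 : 0 < p by exact: lt_trans p1.
have q0 : 0 < N%:R * p / (N%:R - p).
  by rewrite divr_gt0 ?subr_gt0// mulr_gt0// (lt_trans p0).
set q := (X in 0 < X) in q0.
move=> u [/ellE u_ell /(D1p_norm_lty _ _ p0) u_energy].
pose c n : R := n.+1%:R^-1.
have c0 n : 0 < c n by rewrite invr_gt0.
have cle m n : (n <= m)%N -> c m <= c n.
  by move=> nm; rewrite lef_pV2 ?posrE// ler_nat.
have c_small (d : R) : 0 < d -> exists n, c n <= d.
  move=> d0; exists (Num.Def.archi_bound d^-1).
  rewrite /c invf_ple ?posrE//; apply: le_trans (ltW (archi_boundP _)) _.
    by rewrite invr_ge0 ltW.
  by rewrite ler_nat.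
exists (fun n x => u x - clamp (c n) (u x)); split.
- move=> n; apply: (@sub_finite_set _ _ [set x | c n `^ q <= `|u x| `^ q]).
    move=> x /=; apply: contraNT => /= h; rewrite clamp_id ?subrr//.
    move: h; rewrite -ltNge; apply: contraTT; rewrite -ltNge -leNgt => /ltW h.
    by rewrite ge0_ler_powR ?nnegrE ?(ltW q0) ?(ltW (c0 n)).
  by apply: finite_superlevel => //; exact: powR_gt0.
- move=> e e0.
  (* The p-th power of twice the increments of u dominates. *)
  have g_lty : (\esum_(b in edges N)
      (`|(u b.2 - u b.1) + (u b.2 - u b.1)| `^ p)%:E < +oo)%E.
    exact: esum_powR_normD_lty.
  have ep0 : 0 < e `^ p / 2 by rewrite divr_gt0// powR_gt0.
  have [d d0 small] := esum_dominated_small _ _ _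
    (fun=> powR_ge0 _ _) g_lty ep0.
  (* A difference of two truncations has four clamped values in its increment,
     each at most c n0. *)
  have [n0 cn0] : exists n, c n <= d `^ p^-1 / 4.
    by apply: c_small; rewrite divr_gt0// powR_gt0.
  exists n0 => m n n0m n0n; rewrite D1p_norm_lt//.
  apply: (@le_lt_trans _ _ (e `^ p / 2)%:E); last first.
    by rewrite lte_fin ltr_pdivrMr// ltr_pMr ?powR_gt0// ltr1n.
  apply: small => [b|b].
    rewrite powR_ge0/= ge0_ler_powR ?nnegrE ?(ltW p0)//.
    rewrite -mulr2n normrMn mulr2n.
    have := @clamp_lipschitz _ _ (u b.2) (u b.1) (ltW (c0 n)).
    have := @clamp_lipschitz _ _ (u b.2) (u b.1) (ltW (c0 m)).
    rewrite !ler_norml; lra.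
  apply: (@le_trans _ _ ((4 * c n0) `^ p)).
    rewrite ge0_ler_powR ?nnegrE ?(ltW p0) ?mulr_ge0 ?(ltW (c0 _))//.
    have := clamp_norm _ (u b.2) (ltW (c0 n)).
    have := clamp_norm _ (u b.1) (ltW (c0 n)).
    have := clamp_norm _ (u b.2) (ltW (c0 m)).
    have := clamp_norm _ (u b.1) (ltW (c0 m)).
    have := cle _ _ n0m; have := cle _ _ n0n.
    rewrite !ler_norml; lra.
  have -> : d = (d `^ p^-1) `^ p by rewrite -powRrM mulVf ?gt_eqF// powRr1 ?ltW.
  rewrite ge0_ler_powR ?nnegrE ?(ltW p0) ?mulr_ge0 ?(ltW (c0 _)) ?powR_ge0//.
  lra.
- move=> x; apply/cvgrPdist_le => e e0.
  have [n0 cn0] := c_small e e0.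
  near=> n; rewrite opprB addrCA subrr addr0.
  apply: le_trans (clamp_norm _ _ (ltW (c0 n))) _.
  apply: le_trans cn0; apply: cle.
  by near: n; exact: nbhs_infty_ge.
Unshelve. all: by end_near. Qed.

Theorem theorem7 (R : realType) (N : nat) (p : R) :
  (3 <= N)%N -> 1 < p -> p < N%:R -> D1p_0 N p = D1p N p.
Proof.
move=> _ p1 pN; apply/seteqP; split.
  exact: D1p_0_sub.
exact: D1p_sub.
Qed.
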